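(* Let $(n_0,\ldots,n_m)$ be any architecture and let $\theta \in \mathcal{P}_{n_0,\ldots,n_m}$ be any ordinary parameter. Then $$\dim_{\mathrm{fun}}(\theta) \leq n_m + \sum_{i=0}^{m-1} n_i n_{i+1}.$$
   Context: An architecture is a tuple $(n_0,\ldots,n_m)$ of positive integers with $m\ge 1$. Let $\sigma$ denote the map applying $t\mapsto\max\{0,t\}$ to each coordinate of a vector in any $\mathbb{R}^n$. Put $D(n_0,\ldots,n_m)=\sum_{i=1}^m n_i(n_{i-1}+1)$ and $\mathcal{P}_{n_0,\ldots,n_m}=\mathbb{R}^{D(n_0,\ldots,n_m)}$ (parameter space). A parameter $\theta\in\mathcal{P}_{n_0,\ldots,n_m}$ is identified with a list of matrices $[A^i]$ of size $n_i\times(n_{i-1}+1)$, $1\le i\le m$, giving affine maps $A^i:\mathbb{R}^{n_{i-1}}\to\mathbb{R}^{n_i}$, $A^i(x)=[A^i][x,1]^T$. The realization map $\rho$ sends $\theta$ to the function $\rho(\theta)=\sigma\circ A^m\circ\cdots\circ\sigma\circ A^1:\mathbb{R}^{n_0}\to\mathbb{R}^{n_m}$. Let $\mathcal{F}(\theta,x)=\rho(\theta)(x)$. A point $x\in\mathbb{R}^{n_0}$ is parametrically smooth for $\theta$ if $\mathcal{F}:\mathcal{P}_{n_0,\ldots,n_m}\times\mathbb{R}^{n_0}\to\mathbb{R}^{n_m}$ is $C^\infty$ at $(\theta,x)$ (i.e. on a neighborhood of it). A finite set $Z\subset\mathbb{R}^{n_0}$ is parametrically smooth for $\theta$ if all its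 points are. A parameter $\theta$ is ordinary if at least one point of $\mathbb{R}^{n_0}$ is parametrically smooth for $\theta$. For a finite ordered set $Z=\{z_1,\ldots,z_k\}\subset\mathbb{R}^{n_0}$, the evaluation map $E_Z:\mathcal{P}_{n_0,\ldots,n_m}\to\mathbb{R}^{k n_m}$ is $E_Z(\theta)=(\rho(\theta)(z_1),\ldots,\rho(\theta)(z_k))$, and $\mathbf{J}E_Z|_\theta$ is its Jacobian matrix with respect to the parameter coordinates at $\theta$. The functional dimension of an ordinary parameter $\theta$ is $$\dim_{\mathrm{fun}}(\theta)=\sup\{\operatorname{rank}\mathbf{J}E_Z|_\theta : Z\subset\mathbb{R}^{n_0}\text{ finite and parametrically smooth for }\theta\}.$$ *)

(* Defs.v *)
From HB Require Import structures.
From mathcomp Require Import all_boot all_order all_algebra.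
From mathcomp Require Import all_classical all_reals all_analysis.

Set Implicit Arguments.
Unset Strict Implicit.
Unset Printing Implicit Defensive.

Import Order.TTheory GRing.Theory Num.Theory.
Import numFieldNormedType.Exports.

Local Open Scope classical_set_scope.
Local Open Scope ring_scope.

Section Smooth.
Variables (R : realType) (V W : normedModType R).

(* C^k on U, for finite-dimensional V: f is differentiable on U and all its
   directional derivatives are C^(k-1) on U.  Intended for U open. *)
Fixpoint Ck_on (k : nat) (U : set V) (f : V -> W) : Prop :=
  match k with
  | 0 => forall x, U x -> {for x, continuous f}
  | k'.+1 => (forall x, U x -> differentiable f x) /\
             (forall v : V, Ck_on k' U ('D_v f))
  end.

Definition smooth_on (U : set V) (f : V -> W) := forall k, Ck_on k U f.

Definition smooth_at (f : V -> W) (x : V) :=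
  exists U : set V, [/\ open U, U x & smooth_on U f].

End Smooth.

(* An architecture (n_0, ..., n_m) is given by m and by n : nat -> nat, of which
   only the values n 0, ..., n m are ever used. *)
Definition architecture (m : nat) (n : nat -> nat) : Prop :=
  (1 <= m)%N /\ forall i, (i <= m)%N -> (0 < n i)%N.

(* Defined recursively so that a row vector of parameters for m + 1 layers
   splits, by conversion, into the parameters of the first m layers and the
   entries of the last matrix; see param_dimE for the closed form. *)
Fixpoint param_dim (n : nat -> nat) (m : nat) : nat :=
  match m with
  | 0 => 0
  | m'.+1 => param_dim n m' + n m'.+1 * (n m' + 1)
  end.

Lemma param_dimE n m :
  param_dim n m = (\sum_(1 <= i < m.+1) n i * (n i.-1 + 1))%N.
Proof.
elim: m => [|m IHm]; first by rewrite big_geq.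
by rewrite big_nat_recr //= IHm.
Qed.

Section Network.
Variable R : realType.

Definition relu k (y : 'cV[R]_k) : 'cV[R]_k := map_mx (Num.max 0) y.

Definition affine p q (A : 'M[R]_(q, p + 1)) (x : 'cV[R]_p) : 'cV[R]_q :=
  A *m col_mx x (1 : 'cV[R]_1).

Variable n : nat -> nat.

Definition last_layer m (theta : 'rV[R]_(param_dim n m.+1)) :
    'M[R]_(n m.+1, n m + 1) :=
  vec_mx (rsubmx (theta : 'rV[R]_(param_dim n m + n m.+1 * (n m + 1)))).

Definition first_layers m (theta : 'rV[R]_(param_dim n m.+1)) :
    'rV[R]_(param_dim n m) :=
  lsubmx (theta : 'rV[R]_(param_dim n m + n m.+1 * (n m + 1))).

Fixpoint realization (m : nat) :
    'rV[R]_(param_dim n m) -> 'cV[R]_(n 0) -> 'cV[R]_(n m) :=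
  match m with
  | 0 => fun _ x => x
  | m'.+1 => fun theta x =>
      relu (affine (last_layer theta) (realization (first_layers theta) x))
  end.

Variable m : nat.
Implicit Type theta : 'rV[R]_(param_dim n m).

Definition network_map (p : 'rV[R]_(param_dim n m) * 'cV[R]_(n 0)) :
    'cV[R]_(n m) :=
  realization p.1 p.2.

Definition param_smooth theta (x : 'cV[R]_(n 0)) : Prop :=
  smooth_at network_map (theta, x).

Definition ordinary theta : Prop := exists x, param_smooth theta x.

Definition evaluation k (z : 'I_k -> 'cV[R]_(n 0)) theta : 'rV[R]_(k * n m) :=
  mxvec (\matrix_(i < k, j < n m) realization theta (z i) j 0).

(* The library's 'J acts on row vectors, so it is the transpose of the usual
   Jacobian matrix; its rank is the same.  A finite ordered set is an injective
   enumeration z.  The supremum is taken in \bar R, so that it exists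
   whether or not the ranks are known to be bounded. *)
Definition functional_dimension theta : \bar R :=
  ereal_sup [set r : \bar R | exists k (z : 'I_k -> 'cV[R]_(n 0)),
    [/\ injective z, (forall i, param_smooth theta (z i)) &
        r = ((\rank ('J (evaluation z) theta))%:R)%:E]].

End Network.

(* Main.v *)
Require Import Defs.
From HB Require Import structures.
From mathcomp Require Import all_boot all_order all_algebra.
From mathcomp Require Import all_classical all_reals all_analysis.
Import Order.TTheory GRing.Theory Num.Theory.
Import numFieldNormedType.Exports.
Local Open Scope ring_scope.

(* Multiplying the incoming weights and the bias of a hidden neuron by
   1 + s has, for small s, the same effect on the realization as multiplying its
   outgoing weights by 1 + s.  Both are affine curves of parameters, so the
   derivative of the evaluation map takes the same value on their velocities.
   If the bias is nonzero, this expresses the derivative in the direction of the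
   bias through the derivatives in the directions of weights.  Hence, where no
   parameter vanishes, the biases of the hidden neurons do not contribute to the
   rank of the Jacobian.  An arbitrary parameter is reduced to this case by a
   small perturbation, which does not decrease the rank of the Jacobian because
   the realization is smooth near the points considered. *)

Set Implicit Arguments.
Unset Strict Implicit.
Unset Printing Implicit Defensive.

(** * Lower semicontinuity of the rank of a matrix *)

Section MatrixLimits.
Local Open Scope classical_set_scope.
Local Open Scope ring_scope.
Variables (R : realType) (T : Type) (F : set_system T).
Context {FF : Filter F}.

Lemma cvg_near_congr (f g : T -> R) (a b : R) :
  (\forall s \near F, f s = g s) -> b = a -> g s @[s --> F] --> a ->
  f s @[s --> F] --> b.
Proof.
move=> fg -> ga; apply: cvg_trans ga; apply: near_eq_cvg.
by apply: filterS fg => s ->.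
Qed.

Lemma cvg_mulmx_entry p q r (M : T -> 'M[R]_(p, q)) (L : 'M[R]_(p, q))
    (N : T -> 'M[R]_(q, r)) (K : 'M[R]_(q, r)) :
  (forall i j, M s i j @[s --> F] --> L i j) ->
  (forall i j, N s i j @[s --> F] --> K i j) ->
  forall i j, (M s *m N s) i j @[s --> F] --> (L *m K) i j.
Proof.
move=> ML NK i j; rewrite mxE; under eq_fun do rewrite mxE.
apply: (cvg_big (@add_continuous R)) => l _.
by apply: cvgM; [exact: ML|exact: NK].
Qed.

Lemma cvg_det p (M : T -> 'M[R]_p) (L : 'M[R]_p) :
  (forall i j, M s i j @[s --> F] --> L i j) ->
  \det (M s) @[s --> F] --> \det L.
Proof.
move=> ML; rewrite /determinant.
apply: (cvg_big (@add_continuous R)) => l _.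
apply: cvgMr; apply: (cvg_big (@mul_continuous R)) => i _; exact: ML.
Qed.

(** A full-rank factorization of [L] gives [P] and [Q] with [P *m L *m Q] the identity of size
    [\rank L]. The determinant of [P *m M s *m Q] then tends to 1, so this product is eventually
    invertible. *)
Lemma near_rank_ge p q (M : T -> 'M[R]_(p, q)) (L : 'M[R]_(p, q)) :
  (forall i j, M s i j @[s --> F] --> L i j) ->
  \forall s \near F, (\rank L <= \rank (M s))%N.
Proof.
move=> ML.
have /row_fullP[P PL] := col_base_full L.
have /row_freeP[Q LQ] := row_base_free L.
have PLQ : P *m L *m Q = 1%:M.
  by rewrite -[X in P *m X *m Q]mulmx_base mulmxA PL mul1mx LQ.
have cvg1 : \det (P *m M s *m Q) @[s --> F] --> (1 : R).
  rewrite -(det1 R (\rank L)) -PLQ; apply: cvg_det.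
  apply: cvg_mulmx_entry => [|i j]; last exact: cvg_cst.
  by apply: cvg_mulmx_entry => [i j|]; [exact: cvg_cst|exact: ML].
apply: filterS (cvgr_gt _ cvg1 _ ltr01) => s det_gt0.
have /mxrank_unit <- : P *m M s *m Q \in unitmx.
  by rewrite unitmxE unitfE gt_eqF.
exact: leq_trans (mxrankM_maxl _ _) (mxrankM_maxr _ _).
Qed.

End MatrixLimits.

(** * Directional derivatives and small perturbations *)

Section Differentiation.
Local Open Scope classical_set_scope.
Local Open Scope ring_scope.
Variable R : realType.

Lemma differentiable_mx (V : normedModType R) p q (f : V -> 'M[R]_(p, q)) x :
  (forall i j, differentiable (fun t => f t i j) x) -> differentiable f x.
Proof.
move=> df.
have -> : f = \sum_i \sum_j (fun t => f t i j *: delta_mx i j).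
  apply/funext => t; rewrite [LHS]matrix_sum_delta fct_sumE.
  by apply: eq_bigr => i _; rewrite fct_sumE.
apply: differentiable_sum => i; apply: differentiable_sum => j.
exact: differentiableZl.
Qed.

Lemma derive_slice (V W U : normedModType R) (f : V * W -> U) x y v :
  'D_v (fun t => f (t, y)) x = 'D_((v, 0) : V * W) f (x, y).
Proof.
rewrite /derive; suff -> : (fun h : R =>
    h^-1 *: (((fun t => f (t, y)) \o shift x) (h *: v) - f (x, y))) =
  (fun h : R =>
    h^-1 *: ((f \o shift (x, y)) (h *: ((v, 0) : V * W)) - f (x, y))) by [].
apply/funext => h /=.
have -> : h *: ((v, 0) : V * W) + (x, y) = (h *: v + x, h *: 0 + y) by [].
by rewrite scaler0 add0r.
Qed.

Lemma differentiable_slice (V W U : normedModType R) (f : V * W -> U) x y :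
  differentiable f (x, y) -> differentiable (fun t => f (t, y)) x.
Proof.
move=> df; apply: (@differentiable_comp _ _ _ _ (fun t => (t, y)) f _ _ df).
exact: (@differentiable_pair _ _ _ _ id (cst y)).
Qed.

Lemma derive_entry (V : normedModType R) p q (f : V -> 'M[R]_(p, q)) x v i j :
  derivable f x v -> ('D_v f x) i j = 'D_v (fun t => f t i j) x.
Proof. by move=> df; rewrite derive_mx // mxE. Qed.

(** The derivative along [c] is the derivative at 0 of the curve [f (x + s *: c)], which depends
    only on the germ of that curve. *)
Lemma derive_eq_directions (V W : normedModType R) (f : V -> W) x a b :
  (\forall s \near (0 : R), f (x + s *: a) = f (x + s *: b)) ->
  'D_a f x = 'D_b f x.
Proof.
have derive_curve c : 'D_c f x = 'D_1 (fun s : R => f (x + s *: c)) 0.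
  rewrite /derive; suff -> : (fun h : R =>
      h^-1 *: ((f \o shift x) (h *: c) - f x)) =
    (fun h : R => h^-1 *: (((fun s : R => f (x + s *: c)) \o shift 0) (h *: 1)
      - f (x + 0 *: c))) by [].
  apply/funext => h /=; rewrite scale0r !addr0.
  by rewrite [h *: 1]mulr1 (addrC x).
by move=> eq_ab; rewrite !derive_curve; exact: near_eq_derive.
Qed.

Lemma smooth_at_near (V W : normedModType R) (f : V -> W) x :
  smooth_at f x -> (\forall y \near x, differentiable f y) /\
    forall v, {for x, continuous ('D_v f)}.
Proof.
move=> [U [oU Ux sU]]; split.
  by have [dU _] := sU 1%N; apply: (filterS dU); exact: open_nbhs_nbhs.
by move=> v; have [_ /(_ v) cU] := sU 1%N; exact: cU.
Qed.

(** Each coordinate vanishes for exactly one value of [t]. The neighborhood is punctured because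
    this value is 0 when the coordinate of [theta] is zero. *)
Lemma near_neq0_shift p (theta : 'rV[R]_p) :
  \forall t \near (0 : R)^', forall i, (theta + t *: const_mx 1) 0 i != 0.
Proof.
apply: (@filter_forall _ _ (fun i (t : R) =>
  (theta + t *: const_mx 1) 0 i != 0) (dnbhs (0 : R)) _) => i.
have : \forall t \near (0 : R)^', t != - theta 0 i.
  have [->|nz] := eqVneq (- theta 0 i) 0; first exact: nbhs_dnbhs_neq.
  have a_gt0 : 0 < `|- theta 0 i| by rewrite normr_gt0.
  apply: nbhs_dnbhs; apply: filterS (nbhs0_lt a_gt0) => t.
  by apply: contraTneq => ->; rewrite ltxx.
by apply: filterS => t; rewrite !mxE mulr1 addrC addr_eq0.
Qed.

End Differentiation.

(** * Neuron rescaling and the resulting rank bound *)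

Section Scaling.
Local Open Scope classical_set_scope.
Local Open Scope ring_scope.
Variable R : realType.

Lemma relu_diag p (d : 'rV[R]_p) (y : 'cV[R]_p) :
  (forall j, 0 <= d 0 j) -> relu (diag_mx d *m y) = diag_mx d *m relu y.
Proof.
move=> d_ge0; apply/matrixP => i j.
by rewrite !mul_diag_mx !mxE maxr_pMr // mulr0.
Qed.

Lemma affine_diagl p q (d : 'rV[R]_q) (A : 'M[R]_(q, p + 1)) x :
  affine (diag_mx d *m A) x = diag_mx d *m affine A x.
Proof. by rewrite /affine mulmxA. Qed.

Lemma affine_diagr p q (d : 'rV[R]_p) (A : 'M[R]_(q, p + 1)) x :
  affine (A *m block_mx (diag_mx d) 0 0 1%:M) x = affine A (diag_mx d *m x).
Proof.
by rewrite /affine -mulmxA mul_block_col !mul0mx addr0 add0r mul1mx.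
Qed.

Variable n : nat -> nat.

(** Isolates the property of the Jacobian used for the rank bound. Unlike being a Jacobian of an
    evaluation map, it passes to the rows of the first layers, which permits induction on the
    depth. *)
Definition perturbation_invariant m (theta : 'rV[R]_(param_dim n m)) q
    (J : 'M[R]_(param_dim n m, q)) : Prop :=
  forall a b : 'rV[R]_(param_dim n m),
    (\forall s \near (0 : R), forall x,
      realization (theta + s *: a) x = realization (theta + s *: b) x) ->
    a *m J = b *m J.

Lemma first_layersD m (theta a : 'rV[R]_(param_dim n m.+1)) s :
  first_layers (theta + s *: a) = first_layers theta + s *: first_layers a.
Proof. by rewrite /first_layers [LHS]linearD [X in _ + X]linearZ. Qed.

Lemma last_layerD m (theta a : 'rV[R]_(param_dim n m.+1)) s :
  last_layer (theta + s *: a) = last_layer theta + s *: last_layer a.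
Proof.
by rewrite /last_layer [X in vec_mx X]linearD [X in vec_mx (_ + X)]linearZ /=
  linearD linearZ.
Qed.

Lemma first_layers_row m (u : 'rV[R]_(param_dim n m)) v :
  first_layers (row_mx u v : 'rV[R]_(param_dim n m.+1)) = u.
Proof. exact: row_mxKl. Qed.

Lemma last_layer_row m (u : 'rV[R]_(param_dim n m)) A :
  last_layer (row_mx u (mxvec A) : 'rV[R]_(param_dim n m.+1)) = A.
Proof. by rewrite /last_layer row_mxKr mxvecK. Qed.

Lemma last_layer_row0 m (u : 'rV[R]_(param_dim n m)) :
  last_layer (row_mx u 0 : 'rV[R]_(param_dim n m.+1)) = 0.
Proof. by rewrite /last_layer row_mxKr linear0. Qed.

(** Padding a direction with zeros fixes the last layer, so perturbations that agree on the first
    layers still agree after it is applied. *)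
Lemma perturbation_invariant_first m (theta : 'rV[R]_(param_dim n m.+1)) q
    (J1 : 'M[R]_(param_dim n m, q)) (J2 : 'M[R]_(n m.+1 * (n m + 1), q)) :
  perturbation_invariant (m := m.+1) theta (col_mx J1 J2) ->
  perturbation_invariant (first_layers theta) J1.
Proof.
move=> invJ a b eq_ab.
have := invJ (row_mx a 0) (row_mx b 0).
rewrite [row_mx _ _ *m _ as X in X = _]mul_row_col.
rewrite [row_mx _ _ *m _ as X in _ = X]mul_row_col.
rewrite mul0mx !addr0; apply.
apply: filterS eq_ab => s eq_s x /=.
by rewrite !first_layersD !last_layerD !first_layers_row
  !last_layer_row0 eq_s.
Qed.

(** For small [s] the factors [1 + s * c 0 j] are nonnegative, so their diagonal matrix commutes
    with [relu] and can be moved from one layer to the next. *)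
Lemma neuron_scaling m (theta : 'rV[R]_(param_dim n m.+2))
    (c : 'rV[R]_(n m.+1)) :
  \forall s \near (0 : R), forall x,
    realization (theta + s *: row_mx
      (row_mx 0 (mxvec (diag_mx c *m last_layer (first_layers theta)))) 0) x =
    realization (theta + s *: row_mx 0
      (mxvec (last_layer theta *m block_mx (diag_mx c) 0 0 0))) x.
Proof.
have near_pos : \forall s \near (0 : R), forall j, 0 <= 1 + s * c 0 j.
  apply: (@filter_forall _ _ (fun j s => 0 <= 1 + s * c 0 j) (nbhs (0 : R)) _)
    => j.
  have : (1 + s * c 0 j) @[s --> (0 : R)] --> (1 + 0 * c 0 j).
    by apply: cvgD; [exact: cvg_cst|apply: cvgMl; exact: cvg_id].
  rewrite mul0r addr0 => cvg1; exact: (cvgr_ge _ cvg1 _ ltr01).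
apply: filterS near_pos => s s_pos x.
pose d := \row_j (1 + s * c 0 j).
have dE : diag_mx d = 1%:M + s *: diag_mx c.
  apply/matrixP => i j; rewrite !mxE; case: eqP => [->|_].
    by rewrite !mulr1n.
  by rewrite !mulr0n mulr0 addr0.
set A := last_layer (first_layers theta); set B := last_layer theta.
set a := row_mx (row_mx _ _) _; set b := row_mx _ _.
have la : last_layer (a : 'rV_(param_dim n m.+2)) = 0 by exact: last_layer_row0.
have fa : first_layers (a : 'rV_(param_dim n m.+2)) =
    row_mx 0 (mxvec (diag_mx c *m A)).
  exact: first_layers_row.
have lb : last_layer (b : 'rV_(param_dim n m.+2)) =
    B *m block_mx (diag_mx c) 0 0 0.
  exact: last_layer_row.
have fb : first_layers (b : 'rV_(param_dim n m.+2)) = 0.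
  exact: first_layers_row.
rewrite /= !(first_layersD theta) !(last_layerD theta) la fa lb fb.
rewrite (first_layersD (first_layers theta)) (last_layerD (first_layers theta)).
rewrite first_layers_row last_layer_row !scaler0 !addr0 -/A -/B.
have -> : A + s *: (diag_mx c *m A) = diag_mx d *m A.
  by rewrite dE mulmxDl mul1mx scalemxAl.
(* The block [1%:M] leaves the bias column of the next layer unscaled. *)
have -> : B + s *: (B *m block_mx (diag_mx c) 0 0 0) =
    B *m block_mx (diag_mx d) 0 0 1%:M.
  rewrite -[X in X + _]mulmx1 scalemxAr -mulmxDr.
  rewrite (@scalar_mx_block _ (n m.+1) 1 1) scale_block_mx add_block_mx dE.
  by rewrite !scaler0 !addr0.
rewrite affine_diagl affine_diagr relu_diag // => j.
by rewrite mxE s_pos.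
Qed.

Fixpoint weight_dim m : nat :=
  match m with
  | 0 => 0
  | m'.+1 => weight_dim m' + n m'.+1 * n m'
  end.

Lemma weight_dimE m : weight_dim m = (\sum_(0 <= i < m) n i * n i.+1)%N.
Proof.
elim: m => [|m IHm]; first by rewrite big_geq.
by rewrite big_nat_recr //= IHm [X in (_ + X)%N]mulnC.
Qed.

(* The rows span the parameters all of whose biases vanish. *)
Fixpoint weight_params m : 'M[R]_(weight_dim m, param_dim n m) :=
  match m with
  | 0 => 0
  | m'.+1 => block_mx (weight_params m') 0 0 (lin_mulmxr (row_mx 1%:M 0))
  end.

Lemma first_layers_neq0 m (theta : 'rV[R]_(param_dim n m.+1)) :
  (forall i, theta 0 i != 0) -> forall i, first_layers theta 0 i != 0.
Proof. by move=> nz i; rewrite mxE nz. Qed.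

Lemma last_layer_neq0 m (theta : 'rV[R]_(param_dim n m.+1)) :
  (forall i, theta 0 i != 0) -> forall i j, last_layer theta i j != 0.
Proof. by move=> nz i j; rewrite !mxE nz. Qed.

(* Scaling the neurons of layer m.+1 at the rates c, the quotients of the bias
   column of a matrix M by the biases, turns M into a bias-free matrix modulo
   directions of the weights leaving the layer. *)
Lemma last_hidden_layer_sub m (theta : 'rV[R]_(param_dim n m.+2)) q
    (J1 : 'M[R]_(param_dim n m, q)) (J2 : 'M[R]_(n m.+1 * (n m + 1), q))
    (J3 : 'M[R]_(n m.+2 * (n m.+1 + 1), q)) :
  (forall i, theta 0 i != 0) ->
  perturbation_invariant (m := m.+2) theta (col_mx (col_mx J1 J2) J3) ->
  (J2 <= lin_mulmxr (row_mx 1%:M 0) *m J2 + J3)%MS.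
Proof.
move=> nz invJ; apply/row_subP => k.
(* A row of [J2] is the image of an elementary matrix; the argument works for any matrix [M]. *)
rewrite rowE -[delta_mx 0 k]vec_mxK; move: (vec_mx _) => M.
set A := last_layer (first_layers theta).
have Anz : forall i, A i (rshift (n m) 0) != 0.
  by move=> i; exact/last_layer_neq0/first_layers_neq0.
pose c := \row_j (M j (rshift (n m) 0) / A j (rshift (n m) 0)).
have := invJ _ _ (neuron_scaling theta c).
rewrite [row_mx _ _ *m _ as X in X = _]mul_row_col.
rewrite [row_mx _ _ *m _ as X in _ = X]mul_row_col.
rewrite [row_mx _ _ *m _ as X in X + _]mul_row_col.
rewrite !mul0mx !addr0 !add0r -/A => eqJ.
pose N := M - diag_mx c *m A.
have -> : M = N + diag_mx c *m A by rewrite subrK.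
(* By [eqJ] the scaling part of [M] contributes a combination of rows of [J3]; only [N] remains. *)
rewrite linearD /= mulmxDl eqJ addmx_sub_adds ?submxMl //.
(* Multiplication by [row_mx 1%:M 0] appends a zero bias column, and the choice of [c] makes the
   bias column of [N] vanish. *)
have -> : mxvec N = mxvec (lsubmx N) *m lin_mulmxr (row_mx 1%:M 0).
  rewrite mul_vec_lin /= mul_mx_row mulmx1 mulmx0 -[in LHS](hsubmxK N).
  congr (mxvec (row_mx _ _)); apply/matrixP => i j.
  rewrite ord1 !mxE (bigD1 i) //= big1 ?addr0; last first.
    by move=> l li; rewrite !mxE eq_sym (negPf li) mulr0n mul0r.
  by rewrite !mxE eqxx mulr1n mulfVK ?subrr.
by rewrite -mulmxA submxMl.
Qed.

(** Induction on the depth: the biases of the last hidden layer are absorbed using [J2], and those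
    of the earlier layers using the rows [J12] of that layer, which are then already accounted
    for. *)
Lemma perturbation_invariant_sub m (theta : 'rV[R]_(param_dim n m.+1)) q
    (J1 : 'M[R]_(param_dim n m, q)) (J2 : 'M[R]_(n m.+1 * (n m + 1), q)) :
  (forall i, theta 0 i != 0) ->
  perturbation_invariant (m := m.+1) theta (col_mx J1 J2) ->
  (J1 <= weight_params m *m J1 + J2)%MS.
Proof.
elim: m theta J1 J2 => [|m IHm] theta J1 J2 nz invJ.
  by apply/row_subP => -[].
move: invJ; rewrite -(vsubmxK (J1 : 'M[R]_(_ + _, _))).
move: (usubmx _) (dsubmx _) => J11 J12 invJ.
have J12_sub := last_hidden_layer_sub nz invJ.
have J11_sub := IHm _ _ _ (first_layers_neq0 nz)
  (perturbation_invariant_first invJ).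
rewrite mul_block_col !mul0mx addr0 add0r.
have J12_le : (J12 <= col_mx (weight_params m *m J11)
    (lin_mulmxr (row_mx 1%:M 0) *m J12) + J2)%MS.
  apply: submx_trans J12_sub _; rewrite addsmxS //.
  by rewrite -addsmxE addsmxSr.
rewrite -addsmxE addsmx_sub J12_le andbT.
apply: submx_trans J11_sub _; rewrite addsmx_sub J12_le andbT.
by rewrite (submx_trans _ (addsmxSl _ _)) // -addsmxE addsmxSl.
Qed.

(** The hidden layers count only through their weights. The last layer keeps all its parameters, and
    its biases give the term [n m.+1]. *)
Lemma perturbation_invariant_rank m (theta : 'rV[R]_(param_dim n m.+1)) q
    (J : 'M[R]_(param_dim n m.+1, q)) :
  (forall i, theta 0 i != 0) -> perturbation_invariant theta J ->
  (\rank J <= n m.+1 + \sum_(0 <= i < m.+1) n i * n i.+1)%N.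
Proof.
move=> nz; rewrite -(vsubmxK (J : 'M[R]_(_ + _, _))).
move: (usubmx _) (dsubmx _) => J1 J2 invJ.
rewrite big_nat_recr //= -weight_dimE.
have /mxrankS/leq_trans : (col_mx J1 J2 <= weight_params m *m J1 + J2)%MS.
  by rewrite -addsmxE addsmx_sub addsmxSr andbT
    (perturbation_invariant_sub nz invJ).
apply; apply: leq_trans (mxrank_adds_leqif _ _) _.
rewrite addnCA; apply: leq_add.
  by rewrite (leq_trans (mxrankM_maxl _ _)) ?rank_leq_row.
apply: leq_trans (rank_leq_row _) _.
by rewrite mulnDr muln1 addnC [X in (_ + X <= _)%N]mulnC.
Qed.

End Scaling.

(** * The Jacobian of the evaluation map *)

Section Evaluation.
Local Open Scope classical_set_scope.
Local Open Scope ring_scope.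
Variables (R : realType) (n : nat -> nat) (m : nat).
Variables (k : nat) (z : 'I_k -> 'cV[R]_(n 0)).
Implicit Type theta : 'rV[R]_(param_dim n m).

Lemma evaluation_entry theta i j :
  evaluation z theta 0 (mxvec_index i j) = network_map (theta, z i) j 0.
Proof. by rewrite /evaluation mxvecE mxE. Qed.

Lemma differentiable_evaluation theta :
  (forall i, differentiable (@network_map R n m) (theta, z i)) ->
  differentiable (evaluation z) theta.
Proof.
move=> dF; apply: differentiable_mx => i l; rewrite ord1.
case/mxvec_indexP: l => a b; under eq_fun do rewrite evaluation_entry.
apply: (@differentiable_comp _ _ _ _ (fun t => network_map (t, z a))
  (fun y : 'cV[R]_(n m) => y b 0)).
  exact: differentiable_slice.
exact: differentiable_coord.
Qed.

(** The entries are expressed through the joint map in parameter and input, since [param_smooth]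
    gives continuity for its directional derivatives. *)
Lemma jacobian_evaluation_entry theta l i j :
  (forall i, differentiable (@network_map R n m) (theta, z i)) ->
  ('J (evaluation z) theta) l (mxvec_index i j) =
  ('D_((delta_mx 0 l, 0) : 'rV[R]_(param_dim n m) * 'cV[R]_(n 0))
    (@network_map R n m) (theta, z i)) j 0.
Proof.
move=> dF; have dE := differentiable_evaluation dF.
have dFi := differentiable_slice (dF i).
rewrite -derive_slice derive_entry; last exact: diff_derivable.
rewrite mxE -deriveE // derive_entry; last exact: diff_derivable.
by under eq_fun do rewrite evaluation_entry.
Qed.

Lemma near_jacobian_rank_ge theta u :
  (forall i, param_smooth theta (z i)) ->
  \forall t \near (0 : R),
    (forall i, differentiable (@network_map R n m) (theta + t *: u, z i)) /\
    (\rank ('J (evaluation z) theta) <=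
      \rank ('J (evaluation z) (theta + t *: u)%R))%N.
Proof.
move=> smooth_z.
have cvg_curve i : (theta + t *: u, z i) @[t --> (0 : R)] --> (theta, z i).
  have : theta + t *: u @[t --> (0 : R)] --> theta + 0 *: u.
    by apply: cvgD; [|apply: cvgZ; [exact: cvg_id|]]; exact: cvg_cst.
  rewrite scale0r addr0 => cvg_theta.
  exact: (cvg_pair cvg_theta (cvg_cst _)).
have near_diff : \forall t \near (0 : R),
    forall i, differentiable (@network_map R n m) (theta + t *: u, z i).
  apply: (@filter_forall _ _ (fun i t => differentiable
    (@network_map R n m) (theta + t *: u, z i)) (nbhs (0 : R)) _) => i.
  have [diff_near _] := smooth_at_near (smooth_z i).
  exact: (cvg_curve i _ diff_near).
near=> t; split; first by near: t.
near: t; apply: near_rank_ge => l c; case/mxvec_indexP: c => i j.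
have diff0 i' : differentiable (@network_map R n m) (theta, z i').
  by have [/nbhs_singleton] := smooth_at_near (smooth_z i').
pose D := 'D_((delta_mx 0 l, 0) : 'rV[R]_(param_dim n m) * 'cV[R]_(n 0))
  (@network_map R n m).
have D_cvg : (D (theta + t *: u, z i)) j 0 @[t --> (0 : R)] -->
    (D (theta, z i)) j 0.
  have [_ /(_ (delta_mx 0 l, 0)) contD] := smooth_at_near (smooth_z i).
  have D_curve := cvg_comp _ _ (cvg_curve i) contD.
  exact: (cvg_comp _ _ D_curve (@coord_continuous _ _ _ j 0 _)).
(* The entry formula requires differentiability, hence holds only for small [t]. *)
apply: (cvg_near_congr _ (jacobian_evaluation_entry l i j diff0) D_cvg).
by apply: filterS near_diff => t dt; exact: jacobian_evaluation_entry.
Unshelve. all: by end_near.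
Qed.

(** In the row convention [a *m J] is the derivative along [a], and the evaluation depends on the
    parameter only through its realization. *)
Lemma perturbation_invariant_jacobian theta :
  (forall i, differentiable (@network_map R n m) (theta, z i)) ->
  perturbation_invariant theta ('J (evaluation z) theta).
Proof.
move=> dF a b eq_ab; have dE := differentiable_evaluation dF.
rewrite -!deriveEjacobian //; apply: derive_eq_directions.
apply: filterS eq_ab => s eq_s; rewrite /evaluation; congr mxvec.
by apply/matrixP => i j; rewrite !mxE eq_s.
Qed.

End Evaluation.

Theorem theorem7p1 (R : realType) (m : nat) (n : nat -> nat)
    (archi : architecture m n) (theta : 'rV[R]_(param_dim n m))
    (theta_ord : ordinary theta) :
  (functional_dimension theta <=
     ((n m + \sum_(0 <= i < m) n i * n i.+1)%N%:R)%:E)%E.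
Proof.
case: archi => m_gt0 _; case: m m_gt0 theta theta_ord => // m _ theta _.
apply: ge_ereal_sup => _ [k [z [_ smooth_z ->]]]; rewrite lee_fin ler_nat.
(* The punctured neighborhood filter of 0 is proper, so one [t] meets both conditions. *)
have [t [[diff_t rank_t] nz_t]] := filter_ex (filterI
  (nbhs_dnbhs (near_jacobian_rank_ge (const_mx 1) smooth_z))
  (near_neq0_shift theta)).
apply: leq_trans rank_t (perturbation_invariant_rank nz_t _).
exact: perturbation_invariant_jacobian.
Qed.
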